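(* Let $(G,\cdot,\star)$ be a multiplicative Lie algebra and let $I$ be an ideal of $G$ such that $I\subseteq Z(G)$, where $Z(G)$ is the center of the group $G$. Then: (1) the set $G\oplus I=\{(g,a): g\in G, a\in I\}$ forms a multiplicative Lie algebra with respect to the two binary operations $$(g,a)\cdot(h,b):=(gh,ab),\qquad (g,a)\star'(h,b):=\big(g\star h,\ (g\star b)(a\star h)(a\star b)\big)$$ for all $g,h\in G$ and $a,b\in I$; (2) the set $G\rtimes I=\{(g,a): g\in G, a\in I\}$ forms a multiplicative Lie algebra with respect to the two binary operations $$(g,a)\cdot(h,b):=(gh,ab),\qquad (g,a)\star''(h,b):=\big(g\star h,\ (g\star b)(a\star h)\big)$$ for all $g,h\in G$ and $a,b\in I$.
   Context: Write ${}^xy=xyx^{-1}$. A multiplicative Lie algebra is a triple $(G,\cdot,\star)$ where $(G,\cdot)$ is a group (not necessarily abelian) and $\star$ is a binary operation on $G$ such that for all $x,y,z\in G$: (1) $x\star x=1$; (2) $x\star(yz)=(x\star y)\,{}^y(x\star z)$; (3) $(xy)\star z={}^x(y\star z)\,(x\star z)$; (4) $((x\star y)\star{}^yz)((y\star z)\star{}^zx)((z\star x)\star{}^xy)=1$; (5) ${}^z(x\star y)=({}^zx)\star({}^zy)$. An ideal of $G$ is a normal subgroup $H$ of $G$ such that $x\star y\in H$ for all $x\in G$, $y\in H$. (The first is called the excision multiplicative Lie algebra, the second the idealization of $G$ by $I$; despite the notation, $\rtimes$ has the direct product group structure.) *)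

(* Defs.v *)
From HB Require Import structures.
From mathcomp Require Import all_boot.
From mathcomp Require Import boolp classical_sets.

Set Implicit Arguments.
Unset Strict Implicit.
Unset Printing Implicit Defensive.

Local Open Scope group_scope.
Local Open Scope classical_set_scope.

Reserved Notation "x ⋆ y" (at level 38, left associativity).

(* The left conjugate ^x y; the library's y ^ x is x^-1 * y * x instead. *)
Definition lconj (G : groupType) (x y : G) : G := x * y * x^-1.

HB.mixin Record Group_isMultLie G of Group G := {
  star : G -> G -> G;
  starxx : forall x, star x x = 1;
  starMr : forall x y z, star x (y * z) = star x y * lconj y (star x z);
  starMl : forall x y z, star (x * y) z = lconj x (star y z) * star x z;
  star_jacobi : forall x y z,
    star (star x y) (lconj y z) * star (star y z) (lconj z x)
      * star (star z x) (lconj x y) = 1;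
  starJ : forall x y z, lconj z (star x y) = star (lconj z x) (lconj z y)
}.

#[short(type="multLieType")]
HB.structure Definition MultLie := {G of Group_isMultLie G & Group G}.

Notation "x ⋆ y" := (star x y) : group_scope.

Definition center (G : groupType) : set G := [set z | forall x, commute z x].
Arguments center G : clear implicits.

Definition normal_subgroup (G : groupType) (H : set G) : Prop :=
  group_closed [in H] /\ (forall x y, y \in H -> lconj x y \in H).

Definition ideal (G : multLieType) (H : set G) : Prop :=
  normal_subgroup H /\ (forall x y, y \in H -> x ⋆ y \in H).

(* The set S is closed under mulS and starS, and their restrictions to S are
   the two operations of a multiplicative Lie algebra with carrier S. *)
Definition forms_multLie (T : Type) (S : set T) (mulS starS : T -> T -> T) :
    Prop :=
  exists cL : MultLie S, let L := MultLie.Pack cL in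
    forall u v : L, \val (u * v) = mulS (\val u) (\val v) /\
                    \val (u ⋆ v) = starS (\val u) (\val v).

(* Main.v *)
(* Elements of I are central, so there ⋆ is bilinear, conjugation-invariant and
   satisfies the untwisted Jacobi identity.  Both products have the form
   (g ⋆ h, (g ⋆ b) (a ⋆ h) (m a b)), with m a b = a ⋆ b or m a b = 1.  In the
   Jacobi identity the second component lies in the abelian group I and splits
   according to the number of factors drawn from I: the parts of degree 1 and 2
   are each three transposed Jacobi relations, the part of degree 3 is the
   Jacobi relation of m. *)
Require Import Defs.
From HB Require Import structures.
From mathcomp Require Import all_boot.
From mathcomp Require Import boolp classical_sets.

Local Open Scope group_scope.
Local Open Scope classical_set_scope.

(** Polarization: by both distributive laws, [(x * y) ⋆ (x * y) = 1] reduces to a conjugate by [x]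
    of this product. *)
Lemma starC_mul (G : multLieType) (x y : G) : (y ⋆ x) * (x ⋆ y) = 1.
Proof.
have := starxx (x * y).
rewrite starMr !starMl !starxx /lconj !mulg1 mulgV mul1g.
rewrite !mulgA mulgVK => /divg1_eq E.
by apply: (@mulgI _ x); rewrite mulg1 mulgA.
Qed.

Lemma star1g (G : multLieType) (x : G) : 1 ⋆ x = 1.
Proof.
have := starMl 1 1 x; rewrite /lconj invg1 !mulg1 !mul1g => E.
by apply: (@mulgI _ (1 ⋆ x)); rewrite mulg1 -E.
Qed.

Lemma mulg3_rot (G : groupType) (x y z : G) : x * y * z = 1 -> y * z * x = 1.
Proof.
by rewrite -mulgA => /mulg1_eq/(congr1 (fun t => t * x)); rewrite mulVg => <-.
Qed.

(** * Restriction to a subgroup on which the axioms hold *)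

Section SubgroupMultLie.
Variables (P : groupType) (S : set P) (mulS starS : P -> P -> P).
Hypothesis S_group : group_closed [in S].
Hypothesis mulSE : forall x y, mulS x y = x * y.
Hypothesis S_star : forall x y, S x -> S y -> S (starS x y).
Hypothesis Sxx : forall x, S x -> starS x x = 1.
Hypothesis SMr : forall x y z, S x -> S y -> S z ->
  starS x (y * z) = starS x y * lconj y (starS x z).
Hypothesis SMl : forall x y z, S x -> S y -> S z ->
  starS (x * y) z = lconj x (starS y z) * starS x z.
Hypothesis S_jacobi : forall x y z, S x -> S y -> S z ->
  starS (starS x y) (lconj y z) * starS (starS y z) (lconj z x)
    * starS (starS z x) (lconj x y) = 1.
Hypothesis SJ : forall x y z, S x -> S y -> S z ->
  lconj z (starS x y) = starS (lconj z x) (lconj z y).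

(** The injection [\val] of the subtype commutes with products, inverses, conjugation and the star,
    so each axiom is checked in [P] on elements of [S]. *)
Lemma forms_multLie_subgroup : forms_multLie S mulS starS.
Proof.
pose L : groupType :=
  HB.pack (set_type S) (S : subChoiceType [in S])
    (SubChoice_isSubGroup.Build P [in S] (set_type S) S_group).
have vM (u v : L) : \val (u * v) = \val u * \val v by rewrite SubK.
have v1 : \val (1 : L) = 1 by rewrite SubK.
have vV (u : L) : \val u^-1 = (\val u)^-1 by rewrite SubK.
have vJ (u v : L) : \val (lconj u v) = lconj (\val u) (\val v).
  by rewrite /lconj !vM vV.
have vS (u : L) : S (\val u) by apply: set_mem; apply: valP.
pose st (u v : L) : L :=
  Sub (starS (\val u) (\val v)) (mem_set (S_star _ _ (vS u) (vS v))).
have vst (u v : L) : \val (st u v) = starS (\val u) (\val v) by rewrite SubK.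
have axx u : st u u = 1 by apply: val_inj; rewrite vst v1 Sxx.
have aMr x y z : st x (y * z) = st x y * lconj y (st x z).
  by apply: val_inj; rewrite !(vst, vM, vJ) SMr.
have aMl x y z : st (x * y) z = lconj x (st y z) * st x z.
  by apply: val_inj; rewrite !(vst, vM, vJ) SMl.
have aJac x y z : st (st x y) (lconj y z) * st (st y z) (lconj z x)
    * st (st z x) (lconj x y) = 1.
  by apply: val_inj; rewrite !(vst, vM, vJ, v1) S_jacobi.
have aJ x y z : lconj z (st x y) = st (lconj z x) (lconj z y).
  by apply: val_inj; rewrite !(vst, vJ) SJ.
pose M : multLieType :=
  HB.pack (set_type S) L (Group_isMultLie.Build L axx aMr aMl aJac aJ).
exists (MultLie.class M) => /= u v; rewrite mulSE.
by split; [exact: vM|exact: vst].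
Qed.
End SubgroupMultLie.

(** * Calculus of the star on a central ideal *)

Section CentralIdeal.
Variables (G : multLieType) (I : set G).
Hypotheses (hI : ideal I) (hZ : I `<=` center G).
Implicit Types x y z g h k a b c : G.

Lemma ideal1 : I 1.
Proof. by case: hI => -[[I1 _] _] _; apply: set_mem. Qed.

Lemma idealB {a b} : I a -> I b -> I (a / b).
Proof.
by case: hI => -[[_ IB] _] _ Ia Ib; apply/set_mem/IB; apply: mem_set.
Qed.

Lemma idealV {a} : I a -> I a^-1.
Proof. by move=> Ia; rewrite -div1g; apply: idealB => //; apply: ideal1. Qed.

Lemma idealM {a b} : I a -> I b -> I (a * b).
Proof. by move=> Ia Ib; rewrite -[b]invgK; apply: idealB => //; apply: idealV. Qed.

Lemma ideal_starr x {b} : I b -> I (x ⋆ b).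
Proof. by case: hI => _ IS Ib; apply/set_mem/IS; apply: mem_set. Qed.

(** An ideal absorbs on the right by definition; antisymmetry, [a ⋆ x = (x ⋆ a)^-1], carries this to
    the left. *)
Lemma ideal_starl {a} x : I a -> I (a ⋆ x).
Proof.
move=> Ia; have /(congr1 (fun t => t / (x ⋆ a))) := starC_mul _ x a.
by rewrite mulgK mul1g => ->; apply/idealV/ideal_starr.
Qed.

Lemma ideal_commute {a} x : I a -> a * x = x * a.
Proof. by move=> /hZ /(_ x). Qed.

Lemma lconj_idealr x {a} : I a -> lconj x a = a.
Proof. by move=> Ia; rewrite /lconj -(ideal_commute x Ia) mulgK. Qed.

Lemma lconj_ideall {a} x : I a -> lconj a x = x.
Proof. by move=> Ia; rewrite /lconj (ideal_commute x Ia) mulgK. Qed.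

(** Here and in the next three lemmas, the conjugation in the distributive law acts on, or by, an
    element of [I], hence trivially. *)
Lemma star_idealMr x y {c} : I c -> x ⋆ (y * c) = (x ⋆ y) * (x ⋆ c).
Proof. by move=> Ic; rewrite starMr (lconj_idealr y (ideal_starr x Ic)). Qed.

Lemma star_ideallMr {a} y z : I a -> a ⋆ (y * z) = (a ⋆ y) * (a ⋆ z).
Proof. by move=> Ia; rewrite starMr (lconj_idealr y (ideal_starl z Ia)). Qed.

Lemma star_idealMl {a} x y : I a -> (a * x) ⋆ y = (a ⋆ y) * (x ⋆ y).
Proof.
move=> Ia; rewrite starMl (lconj_ideall _ Ia).
by rewrite (ideal_commute _ (ideal_starl _ Ia)).
Qed.

Lemma star_idealrMl x y {c} : I c -> (x * y) ⋆ c = (x ⋆ c) * (y ⋆ c).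
Proof.
move=> Ic; rewrite starMl (lconj_idealr _ (ideal_starr _ Ic)).
by rewrite (ideal_commute _ (ideal_starr _ Ic)).
Qed.

Lemma star_lconjl z x {b} : I b -> lconj z x ⋆ b = x ⋆ b.
Proof.
move=> Ib; rewrite -{1}(lconj_idealr z Ib) -starJ.
by rewrite (lconj_idealr z (ideal_starr x Ib)).
Qed.

Lemma star_lconjr z {a} x : I a -> a ⋆ lconj z x = a ⋆ x.
Proof.
move=> Ia; rewrite -{1}(lconj_idealr z Ia) -starJ.
by rewrite (lconj_idealr z (ideal_starl x Ia)).
Qed.

(** Centrality of [c] removes two of the conjugations in the axiom; the third is paired with
    [c ⋆ g], which lies in [I]. *)
Lemma ideal_jacobi g h {c} : I c ->
  ((g ⋆ h) ⋆ c) * ((h ⋆ c) ⋆ g) * ((c ⋆ g) ⋆ h) = 1.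
Proof.
move=> Ic; have := star_jacobi g h c.
rewrite (lconj_idealr h Ic) (lconj_ideall g Ic).
by rewrite (star_lconjr _ _ (ideal_starl _ Ic)).
Qed.

Lemma ideal_mulACA a {b c} d : I b -> (a * b) * (c * d) = (a * c) * (b * d).
Proof. by move=> Ib; rewrite !mulgA -(mulgA a) (ideal_commute c Ib) !mulgA. Qed.

Lemma ideal_mul3ACA a1 {b1} a2 {b2} a3 {b3} : I b1 -> I b2 ->
  (a1 * b1) * (a2 * b2) * (a3 * b3) = (a1 * a2 * a3) * (b1 * b2 * b3).
Proof.
by move=> I1 I2; rewrite (ideal_mulACA _ _ I1) (ideal_mulACA _ _ (idealM I1 I2)).
Qed.

(* The hypotheses are the broken diagonals of the matrix with rows p, q, r. *)
Lemma ideal_diagonals {p1 p2 p3 q1 q2 q3 r1 r2 r3} :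
  I p1 -> I p2 -> I p3 -> I q1 -> I q2 -> I q3 -> I r1 -> I r2 -> I r3 ->
  p1 * q2 * r3 = 1 -> p2 * q3 * r1 = 1 -> p3 * q1 * r2 = 1 ->
  (p1 * p2 * p3) * (q1 * q2 * q3) * (r1 * r2 * r3) = 1.
Proof.
move=> Ip1 Ip2 Ip3 Iq1 Iq2 Iq3 Ir1 Ir2 Ir3 E1 E2 E3.
(* Rotating the rows [q] and [r] cyclically turns the broken diagonals into columns, which
   [ideal_mul3ACA] then collects. *)
rewrite -(mulgA q1) (ideal_commute _ Iq1) -(ideal_commute (r1 * r2) Ir3) (mulgA r3).
rewrite (ideal_mul3ACA _ _ _ Ip3 Iq1) (ideal_mul3ACA _ _ _ Ip2 Iq3).
by rewrite E1 E2 E3 !mul1g.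
Qed.

(** * Both products at once, with a parameter [m] on the ideal *)

Section IdealForm.
Variable m : G -> G -> G.
Hypothesis mI : forall {a b}, I a -> I b -> I (m a b).
Hypothesis mxx : forall {a}, I a -> m a a = 1.
Hypothesis mMr : forall {a b c}, I a -> I b -> I c -> m a (b * c) = m a b * m a c.
Hypothesis mMl : forall {a b c}, I a -> I b -> I c -> m (a * b) c = m a c * m b c.
Hypothesis m_jacobi : forall {a b c}, I a -> I b -> I c ->
  m (m a b) c * m (m b c) a * m (m c a) b = 1.
Hypothesis m_star_jacobi : forall {a b} k, I a -> I b ->
  (m a b ⋆ k) * m (b ⋆ k) a * m (k ⋆ a) b = 1.

Let pstar : G * G -> G * G -> G * G :=
  fun '(g, a) '(h, b) => (g ⋆ h, (g ⋆ b) * (a ⋆ h) * m a b).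

(** Sorts one Jacobi term by the number of factors from [I]. The order inside each group is chosen
    so that the three cyclic copies of this formula form the matrix of [ideal_diagonals]. *)
Lemma pstar_expand g h k {a b c} : I a -> I b -> I c ->
  let u := (g ⋆ b) * (a ⋆ h) * m a b in
  ((g ⋆ h) ⋆ c) * (u ⋆ lconj h k) * m u c =
  (((g ⋆ h) ⋆ c) * ((g ⋆ b) ⋆ k) * ((a ⋆ h) ⋆ k)) *
  ((m a b ⋆ k) * m (a ⋆ h) c * m (g ⋆ b) c) * m (m a b) c.
Proof.
move=> Ia Ib Ic u.
have Igb := ideal_starr g Ib; have Iah := ideal_starl h Ia.
have Iab := mI Ia Ib.
rewrite /u (star_lconjr _ _ (idealM (idealM Igb Iah) Iab)).
rewrite (star_idealMl _ _ (idealM Igb Iah)) (star_idealMl _ _ Igb).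
rewrite (mMl (idealM Igb Iah) Iab Ic) (mMl Igb Iah Ic).
by rewrite (ideal_commute (m (a ⋆ h) c) (mI Igb Ic)) !mulgA.
Qed.

Lemma pstar_jacobi_snd g h k {a b c} : I a -> I b -> I c ->
  let u := (g ⋆ b) * (a ⋆ h) * m a b in
  let v := (h ⋆ c) * (b ⋆ k) * m b c in
  let w := (k ⋆ a) * (c ⋆ g) * m c a in
  (((g ⋆ h) ⋆ c) * (u ⋆ lconj h k) * m u c) *
  (((h ⋆ k) ⋆ a) * (v ⋆ lconj k g) * m v a) *
  (((k ⋆ g) ⋆ b) * (w ⋆ lconj g h) * m w b) = 1.
Proof.
move=> Ia Ib Ic u v w; rewrite !pstar_expand //.
have Ir x y := @ideal_starr x y; have Il x y := @ideal_starl x y.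
have IM x y := @idealM x y; have Im x y := @mI x y.
(* The degree 3 parts are split off and cancel; the next line separates degree 1 from degree 2. *)
rewrite ideal_mul3ACA ?m_jacobi; [|by auto 10..].
rewrite mulg1 ideal_mul3ACA; [|by auto 10..].
(* The diagonals are Jacobi relations only up to cyclic rotation, which [rot] lets [auto] supply. *)
have rot := @mulg3_rot G.
rewrite -[RHS]mulg1; congr (_ * _); apply: ideal_diagonals;
  by auto 10 using ideal_jacobi.
Qed.

Lemma forms_multLie_ideal_form :
  forms_multLie ([set: G] `*` I) (fun '(g, a) '(h, b) => (g * h, a * b)) pstar.
Proof.
have Ir x y := @ideal_starr x y; have Il x y := @ideal_starl x y.
have IM x y := @idealM x y; have Im x y := @mI x y.
apply: forms_multLie_subgroup.
- split=> [|[g a] [h b] /set_mem[_ Ia] /set_mem[_ Ib]]; apply: mem_set; split=> //.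
    exact: ideal1.
  exact: idealB.
- by move=> [g a] [h b].
- by move=> [g a] [h b] [_ /= Ia] [_ /= Ib]; split=> //=; auto 10.
- by move=> [g a] [_ /= Ia]; rewrite /pstar starxx starC_mul mxx ?mulg1.
- move=> [g a] [h b] [k c] [_ /= Ia] [_ /= Ib] [_ /= Ic].
  apply: (congr2 pair); first exact: starMr.
  (* Conjugation in [G * G] is componentwise; on the second component it acts inside [I], so it
     disappears. *)
  rewrite /= -!/(lconj _ _) lconj_idealr; last by auto 10.
  rewrite star_idealMr // star_ideallMr // mMr //.
  by apply: ideal_mul3ACA; auto.
- move=> [g a] [h b] [k c] [_ /= Ia] [_ /= Ib] [_ /= Ic].
  apply: (congr2 pair); first exact: starMl.
  rewrite /= -!/(lconj _ _) lconj_idealr; last by auto 10.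
  rewrite star_idealrMl // star_idealMl // mMl //.
  rewrite ideal_mul3ACA; [|by auto..].
  by apply: ideal_commute; auto 10.
- move=> [g a] [h b] [k c] [_ /= Ia] [_ /= Ib] [_ /= Ic].
  apply: (congr2 pair); first exact: star_jacobi.
  rewrite /= -!/(lconj _ _).
  rewrite (lconj_idealr _ Ia) (lconj_idealr _ Ib) (lconj_idealr _ Ic).
  exact: pstar_jacobi_snd.
- move=> [g a] [h b] [k c] [_ /= Ia] [_ /= Ib] [_ /= Ic].
  apply: (congr2 pair); first exact: starJ.
  rewrite /= -!/(lconj _ _) (lconj_idealr _ Ia) (lconj_idealr _ Ib).
  by rewrite star_lconjl // star_lconjr // lconj_idealr; auto 10.
Qed.

End IdealForm.
End CentralIdeal.

Theorem theorem2p2 (G : multLieType) (I : set G) (hI : ideal I)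
    (hZ : I `<=` center G) :
  forms_multLie ([set: G] `*` I)
    (fun '(g, a) '(h, b) => (g * h, a * b))
    (fun '(g, a) '(h, b) => (g ⋆ h, (g ⋆ b) * (a ⋆ h) * (a ⋆ b))) /\
  forms_multLie ([set: G] `*` I)
    (fun '(g, a) '(h, b) => (g * h, a * b))
    (fun '(g, a) '(h, b) => (g ⋆ h, (g ⋆ b) * (a ⋆ h))).
Proof.
split.
  apply: (@forms_multLie_ideal_form G I hI hZ star).
  - by move=> a b _; apply: (ideal_starr _ _ hI).
  - by move=> a _; apply: starxx.
  - by move=> a b c _ _ Ic; apply: (star_idealMr _ _ hI hZ).
  - by move=> a b c Ia _ _; apply: (star_idealMl _ _ hI hZ).
  - by move=> a b c _ _ Ic; apply: (ideal_jacobi _ _ hI hZ).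
  (* Two rotations put [a], an element of [I], in the last position required by [ideal_jacobi]. *)
  - move=> a b k Ia Ib; apply/(@mulg3_rot G)/(@mulg3_rot G).
    exact: (ideal_jacobi _ _ hI hZ).
(* A trailing factor [1] exhibits the second product as the case of constant [m]. *)
have -> : (fun '(g, a) '(h, b) => (g ⋆ h, (g ⋆ b) * (a ⋆ h))) =
    (fun '(g, a) '(h, b) => (g ⋆ h, (g ⋆ b) * (a ⋆ h) * 1))
    :> (G * G -> G * G -> G * G).
  by apply/funext => -[g a]; apply/funext => -[h b]; rewrite mulg1.
apply: (@forms_multLie_ideal_form G I hI hZ (fun _ _ => 1)) => *;
  rewrite ?star1g ?mulg1 //; exact: ideal1.
Qed.
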